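(* Consider cost tensors $C\in(\mathbb{R}^n)^{\otimes k}$ that have low-rank plus sparse structure of rank $r$ and sparsity $s$. For any fixed $r$, Algorithm A (the explicit algorithm given in the context) runs in $\mathrm{poly}(n,k,s,C_{\max}/\varepsilon)$ time and solves the $\varepsilon$-approximate $\mathsf{AMIN}_C$ oracle. Furthermore, Algorithm A also solves the $\mathsf{SMIN}_{\tilde{C}}$ oracle for $\eta=(2k\log n)/\varepsilon$ on some cost tensor $\tilde{C}\in(\mathbb{R}^n)^{\otimes k}$ satisfying $\|C-\tilde{C}\|_{\max}\le\varepsilon/2$.
   Context: Notation: $[n]=\{1,\dots,n\}$; $\vec{j}=(j_1,\dots,j_k)\in[n]^k$; $\|A\|_{\max}=\max_{\vec{j}}|A_{\vec{j}}|$, also written $A_{\max}$ (so $C_{\max}=\|C\|_{\max}$, $R_{\max}=\|R\|_{\max}$); $\bar{\mathbb{R}}=\mathbb{R}\cup\{-\infty\}$, with conventions $e^{-\infty}=0$, $\log 0=-\infty$; $f[A]$ denotes the univariate function $f$ applied entrywise to $A$. Runtimes count arithmetic operations; inputs have bit complexity at most $\mathrm{poly}(n,k)$. $\mathsf{AMIN}_C$ oracle: given $p=(p_1,\dots,p_k)\in\mathbb{R}^{n\times k}$ and accuracy $\varepsilon>0$, return $\min_{\vec{j}\in[n]^k}\big(C_{\vec{j}}-\sum_{i=1}^k[p_i]_{j_i}\big)$ up to additive error $\varepsilon$. $\mathsf{SMIN}_{\tilde C}$ oracle: given $p\in\bar{\mathbb{R}}^{n\times k}$ and $\eta>0$, return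 $-\frac1\eta\log\sum_{\vec{j}\in[n]^k}\exp\big(-\eta(\tilde{C}_{\vec{j}}-\sum_{i=1}^k[p_i]_{j_i})\big)$. Low-rank plus sparse structure: $C$ has this structure with rank $r$ and sparsity $s$ if $C=R+S$ where $R$ is a rank-$r$ tensor and $S$ is an $s$-sparse tensor (at most $s$ non-zero entries). A rank-$r$ factorization of $R$ is a collection of vectors $\{u_{i,\ell}\}_{i\in[k],\ell\in[r]}\subset\mathbb{R}^n$ with $R=\sum_{\ell=1}^r\bigotimes_{i=1}^k u_{i,\ell}$; the rank is the minimal such $r$. Standing assumptions: $S$ is input through its $s$ non-zero entries, $R$ is input through a rank-$r$ factorization, and the entries of both $R$ and $S$ are of size $O(C_{\max})$. Algorithm A. Input: $R$ (factored), $S$, $p\in\bar{\mathbb{R}}^{n\times k}$, accuracy $\varepsilon>0$. (1) Set $\eta=(2k\log n)/\varepsilon$. (2) Set $\tilde\varepsilon=\frac{\varepsilon}{3}e^{-\eta R_{\max}}$ and compute, in factored form, a low-rank tensor $L$ with $\|L-\exp[-\eta R]\|_{\max}\le\tilde\varepsilon$, as follows: take a polynomial $q(x)=\sum_{t=0}^m a_tx^t$ of degree $m=O(\log(1/\tilde\varepsilon))$ with $|e^{-\eta x}-q(x)|\le\tilde\varepsilon$ for all $x\in[-R_{\max},R_{\max}]$ (e.g. from the Taylor or Chebyshev expansion of $x\mapsto e^{-\eta x}$), and let $L=q[R]=\sum_{\alpha\in\mathbb{N}_0^r,\,|\alpha|\le m}\bigotimes_{i=1}^k v_{i,\alpha}$,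 where $|\alpha|=\sum_\ell\alpha_\ell$ and $v_{i,\alpha}\in\mathbb{R}^n$ has $j$-th entry $\binom{|\alpha|}{\alpha}a_{|\alpha|}\prod_{\ell=1}^r[u_{i,\ell}]_j^{\alpha_\ell}$ for $i=1$ and $\prod_{\ell=1}^r[u_{i,\ell}]_j^{\alpha_\ell}$ for $i>1$. Below, $d_i=\exp[\eta p_i]$ and $\tilde R=-\eta^{-1}\log[L]$ (never formed explicitly; $e^{-\eta\tilde R_{\vec j}}=L_{\vec j}$). (3) Compute $a=\sum_{\vec{j}:\,S_{\vec{j}}\neq0}\prod_{i=1}^k[d_i]_{j_i}\cdot e^{-\eta\tilde R_{\vec{j}}}\cdot(e^{-\eta S_{\vec{j}}}-1)$ by enumerating over the non-zero entries of $S$. (4) Compute $b=\sum_{\vec{j}\in[n]^k}\prod_{i=1}^k[d_i]_{j_i}\cdot e^{-\eta\tilde R_{\vec{j}}}$ from the factorization of $L$, via $b=\sum_{\alpha}\prod_{i=1}^k\langle d_i,v_{i,\alpha}\rangle$. (5) Return $-\eta^{-1}\log(a+b)$.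
   Formalization: Assumes n ≥ 2, k ≥ 1 (else η = 0 or no first factor) and ε/3 ≤ 1 − n^{−k} (true if ε ≤ 3/2): beyond it R = S = 0 with q = 1 − ε/3 gives ‖C − C̃‖ > ε/2, and for ε ≥ 3 log L may be undefined. R_max is taken as known to the algorithm. *)

(* Defs.v *)
From HB Require Import structures.
From mathcomp Require Import all_boot all_order all_algebra.
From mathcomp Require Import all_classical all_reals all_analysis.

Set Implicit Arguments.
Unset Strict Implicit.
Unset Printing Implicit Defensive.

Import Order.TTheory GRing.Theory Num.Theory.

Local Open Scope ring_scope.

Definition idx (n k : nat) := {ffun 'I_k -> 'I_n}.
Definition tensor (R : realType) (n k : nat) := {ffun idx n k -> R}.

Definition maxnorm (R : realType) n k (A : tensor R n k) : R :=
  \big[Num.max/0]_(j : idx n k) `|A j|.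

(** [u i l] is the vector $u_{i,\ell}$ of $\mathbb R^n$. *)
Definition factors (R : realType) (n k r : nat) := 'I_k -> 'I_r -> 'I_n -> R.

Definition cp_tensor (R : realType) n k r (u : factors R n k r) : tensor R n k :=
  [ffun j : idx n k => \sum_(l < r) \prod_(i < k) u i l (j i)].

Definition tensor_rank (R : realType) n k (A : tensor R n k) (r : nat) : Prop :=
  (exists u : factors R n k r, A = cp_tensor u) /\
  (forall r' (u : factors R n k r'), A = cp_tensor u -> (r <= r')%N).

Definition sparse (R : realType) n k (A : tensor R n k) (s : nat) : Prop :=
  (#|[set j | A j != 0%R]| <= s)%N.

(** [l] lists, without repetition, the non-zero entries of [A] together with
    their positions. *)
Definition nonzero_entries (R : realType) n k
    (A : tensor R n k) (l : seq (idx n k * R)) : Prop :=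
  uniq (unzip1 l) /\ (forall j x, (j, x) \in l <-> A j = x /\ x != 0).

(** The minimum is taken in the extended reals so that $+\infty$ can serve as
    the neutral element; it is a real number as soon as $[n]^k$ is nonempty. *)
Definition AMIN (R : realType) n k (C : tensor R n k)
    (p : 'I_k -> 'I_n -> R) : \bar R :=
  \big[Order.min/+oo%E]_(j : idx n k) (C j - \sum_(i < k) p i (j i))%:E.

(** The value is $+\infty$ when all the summands vanish. *)
Definition SMIN (R : realType) n k (C : tensor R n k)
    (p : 'I_k -> 'I_n -> \bar R) (eta : R) : \bar R :=
  ((- eta^-1)%:E *
   lne (\sum_(j : idx n k)
          expeR ((- eta)%:E * ((C j)%:E - \sum_(i < k) p i (j i)))%E))%E.

(** A value together with the number of arithmetic operations spent on it.
    Every operation on numbers costs one unit; control flow, indexing and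
    memory accesses are free.  Numerals [n%:R] are constants. *)

Definition timed (A : Type) := (A * nat)%type.

Definition result {A : Type} (x : timed A) : A := x.1.
Definition ops {A : Type} (x : timed A) : nat := x.2.

Definition retT {A : Type} (x : A) : timed A := (x, 0%N).
Definition bindT {A B : Type} (x : timed A) (f : A -> timed B) : timed B :=
  (result (f (result x)), (ops x + ops (f (result x)))%N).

Notation "'let*' x ':=' e 'in' f" := (bindT e (fun x => f))
  (at level 200, x name, e at level 200, f at level 200,
   format "'[v' 'let*'  x  ':='  e  'in' '/' f ']'").

Section Primitives.
Variable R : realType.

Definition addT (x y : R) : timed R := (x + y, 1%N).
Definition subT (x y : R) : timed R := (x - y, 1%N).
Definition mulT (x y : R) : timed R := (x * y, 1%N).
Definition divT (x y : R) : timed R := (x / y, 1%N).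
Definition oppT (x : R) : timed R := (- x, 1%N).
Definition invT (x : R) : timed R := (x^-1, 1%N).
Definition expT (x : R) : timed R := (expR x, 1%N).
Definition lnT (x : R) : timed R := (ln x, 1%N).

(** Operations with an argument or a value in the extended reals:
    $e^{-\infty} = 0$ and $\log 0 = -\infty$. *)
Definition mulET (x : R) (y : \bar R) : timed (\bar R) := ((x%:E * y)%E, 1%N).
Definition expET (x : \bar R) : timed R := (fine (expeR x), 1%N).
Definition lnET (x : R) : timed (\bar R) := (lne x%:E, 1%N).

(** Truncation to a natural number, by counting up to it. *)
Definition truncT (x : R) : timed nat := (Num.truncn x, (Num.truncn x).+1).

Definition powT (x : R) (e : nat) : timed R := (x ^+ e, e).
Definition factT (e : nat) : timed R := (e`!%:R, e).

Definition sumT (I : Type) (s : seq I) (f : I -> timed R) : timed R :=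
  (\sum_(i <- s) result (f i), (\sum_(i <- s) (ops (f i)).+1)%N).
Definition prodT (I : Type) (s : seq I) (f : I -> timed R) : timed R :=
  (\prod_(i <- s) result (f i), (\sum_(i <- s) (ops (f i)).+1)%N).
Definition tabT (I : finType) (f : I -> timed R) : timed (I -> R) :=
  (fun i => result (f i), (\sum_(i : I) ops (f i))%N).
Definition listT (m : nat) (f : nat -> timed R) : timed (seq R) :=
  (mkseq (fun t => result (f t)) m, (\sum_(t < m) ops (f t))%N).

End Primitives.

(** A subroutine takes $\eta$, $R_{\max}$, $\tilde\varepsilon$ and returns the
    coefficients $a_0, \dots, a_m$ of a polynomial. *)

Definition subroutine (R : realType) := R -> R -> R -> timed (seq R).

(** The constant [c] is the one of the bound $m = O(\log(1/\tilde\varepsilon))$;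
    it also bounds the (polynomial in $\log(1/\tilde\varepsilon)$) running time
    of the subroutine.  In the algorithm below,
    $\tilde\varepsilon \le e^{-\eta R_{\max}}$ means $\varepsilon \le 3$; without
    it a degree $O(\log(1/\tilde\varepsilon))$ is out of reach. *)
Definition exp_approx (R : realType) (c : nat) (G : subroutine R) : Prop :=
  forall eta Rmax teps : R,
    0 < eta -> 0 <= Rmax -> 0 < teps -> teps <= expR (- (eta * Rmax)) ->
    let a := result (G eta Rmax teps) in
    [/\ ((size a).-1)%:R <= c%:R * ln teps^-1,
        forall x : R, - Rmax <= x <= Rmax ->
          `|expR (- (eta * x)) - (Poly a).[x]| <= teps
      & (ops (G eta Rmax teps))%:R <= c%:R * (1 + ln teps^-1) ^+ c].

(** Taylor expansion of $x \mapsto e^{-\eta x}$ at $0$, up to degree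
    $\lfloor 8 \log(1/\tilde\varepsilon) \rfloor$. *)
Definition taylor (R : realType) : subroutine R := fun eta Rmax teps =>
  let* x := invT teps in
  let* y := lnT x in
  let* z := mulT 8%:R y in
  let* m := truncT z in
  let* neta := oppT eta in
  listT m.+1 (fun t =>
    let* num := powT neta t in
    let* den := factT R t in
    divT num den).

(** The multi-indices $\alpha \in \mathbb N_0^r$ with $|\alpha| \le m$. *)
Definition multi_index (r m : nat) :=
  {al : {ffun 'I_r -> 'I_m.+1} | (\sum_(l < r) al l <= m)%N}.

Section Algorithm.
Variables (R : realType) (n k r : nat).

Definition weight m (al : multi_index r m) : nat := (\sum_(l < r) val al l)%N.

Definition multinomialT m (al : multi_index r m) : timed R :=
  let* num := factT R (weight al) in
  let* den := prodT (enum 'I_r) (fun l => factT R (val al l)) in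
  divT num den.

(** The entry $[v_{i,\alpha}]_j$; the scalar factor is put in the first vector,
    whose index is $0$ here. *)
Definition factor_entryT (u : factors R n k r) (a : seq R) m
    (i : 'I_k) (al : multi_index r m) (j : 'I_n) : timed R :=
  let* w := prodT (enum 'I_r) (fun l => powT (u i l j) (val al l)) in
  if val i == 0%N then
    let* b := multinomialT al in
    let* ba := mulT b a`_(weight al) in
    mulT ba w
  else retT w.

(** [Rmax] stands for $R_{\max}$, which the algorithm uses but does not compute;
    [S] is the list of the non-zero entries of the sparse part. *)
Definition algA (G : subroutine R) (u : factors R n k r) (Rmax : R)
    (S : seq (idx n k * R)) (p : 'I_k -> 'I_n -> \bar R) (eps : R)
    : timed (\bar R) :=
  let* logn := lnT n%:R in
  let* twok := mulT 2 k%:R in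
  let* klogn := mulT twok logn in
  let* eta := divT klogn eps in
  let* eps3 := divT eps 3 in
  let* etaR := mulT eta Rmax in
  let* netaR := oppT etaR in
  let* decay := expT netaR in
  let* teps := mulT eps3 decay in
  let* a := G eta Rmax teps in
  let m := (size a).-1 in
  let* v := tabT (fun x : 'I_k * multi_index r m * 'I_n =>
              factor_entryT u a x.1.1 x.1.2 x.2) in
  let* d := tabT (fun x : 'I_k * 'I_n =>
              let* y := mulET eta (p x.1 x.2) in expET y) in
  let* neta := oppT eta in
  let* sa := sumT S (fun e : idx n k * R =>
    let* dj := prodT (enum 'I_k) (fun i => retT (d (i, e.1 i))) in
    let* Lj := sumT (enum {: multi_index r m}) (fun al =>
                 prodT (enum 'I_k) (fun i => retT (v (i, al, e.1 i)))) in
    let* x := mulT neta e.2 in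
    let* y := expT x in
    let* z := subT y 1 in
    let* dL := mulT dj Lj in
    mulT dL z) in
  let* sb := sumT (enum {: multi_index r m}) (fun al =>
    prodT (enum 'I_k) (fun i =>
      sumT (enum 'I_n) (fun j => mulT (d (i, j)) (v (i, al, j))))) in
  let* sab := addT sa sb in
  let* lg := lnET sab in
  let* ieta := invT eta in
  let* nieta := oppT ieta in
  mulET nieta lg.

End Algorithm.

(** [x] is a fraction whose numerator and denominator have at most [b] bits. *)
Definition bit_complexity_le (R : realType) (x : R) (b : nat) : Prop :=
  exists (num : int) (den : nat),
    [/\ (0 < den)%N, x = num%:~R / den%:R, (`|num| < 2 ^ b)%N
      & (den < 2 ^ b)%N].

(* Main.v *)
Require Import Defs.
From HB Require Import structures.
From mathcomp Require Import all_boot all_order all_algebra.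
From mathcomp Require Import all_classical all_reals all_analysis.
From mathcomp Require Import ring lra zify.

(** The number a + b returned by the algorithm through a logarithm is, exactly,
    a sum over all positions
      a + b = \sum_j (\prod_i [d_i]_(j_i)) * q(R_j) * exp(- eta S_j),
    because b sums the same terms without the sparse factor, and a corrects them
    at the non-zero entries of S; elsewhere exp(- eta S_j) - 1 vanishes
    ([algA_result]).  That the factored form of L represents q[R] is the
    multinomial theorem ([low_rank_entry]).

    The tolerance is eps/3 times the least value of exp(- eta y) for |y| <= Rmax,
    so q(R_j) equals exp(- eta R_j) up to a relative error eps/3.  Hence q(R_j)
    is positive, and it is exp(- eta R'_j) for a tensor R' with
      |R - R'| <= - ln(1 - eps/3) / eta <= k ln n / eta = eps/2,
    the second inequality being the hypothesis eps/3 <= 1 - n^-k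
    ([log_perturbation]).  The algorithm is therefore an exact soft minimum for
    the cost R' + S, even when some potentials are -oo, since then d_i = 0 at
    these entries ([algA_result_SMIN]).  A soft minimum over n^k terms is within
    ln(n^k) / eta = eps/2 of the minimum, and moving the cost by eps/2 moves the
    minimum by at most eps/2; the two errors add up to eps
    ([SMIN_approximates_AMIN]).

    For the running time, the operations are bounded by a fixed polynomial in
    the operations of the subroutine, its degree m, n, k and s ([algA_ops]): for
    fixed r there are only (m+1)^r multi-indices.  By assumption m is at most linear in
      ln(1/teps) = ln 3 + ln(1/eps) + eta Rmax,
    whose second term is at most the bit complexity of eps, and whose third term
    is O(k n Cmax/eps) ([algA_polynomial_time]).

    Finally a Taylor expansion meets the demands on the subroutine: the exponent
    satisfies |eta x| <= ln(1/teps), and a degree a few times larger than that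
    bound already gives an exponentially small remainder
    ([taylor_exp_approx]). *)

Set Implicit Arguments.
Unset Strict Implicit.
Unset Printing Implicit Defensive.

Import Order.TTheory GRing.Theory Num.Theory.

Local Open Scope ring_scope.

(** * Taylor approximation of the exponential *)

Lemma exp_partial_sum_le (R : realType) (x : R) (N : nat) :
  0 <= x -> \sum_(0 <= t < N) x ^+ t / t`!%:R <= expR x.
Proof.
move=> x0; apply: (@nondecreasing_cvgn_le _ (series (exp_coeff x))).
  move=> a b ab; rewrite -subr_ge0 sub_series_geq//.
  by apply: sumr_ge0 => i _; exact: exp_coeff_ge0.
exact: is_cvg_series_exp_coeff.
Qed.

(** Multiplying the t-th term of the remainder by (z^t / z^N) >= 1 turns it into
    a piece of the series of exp(z |x|); the free parameter z trades the growth
    of the exponential for the geometric gain z^-N. *)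
Lemma exp_taylor_remainder (R : realType) (x z : R) (N : nat) : 1 <= z ->
  `|expR x - \sum_(t < N) x ^+ t / t`!%:R| <= expR (z * `|x|) / z ^+ N.
Proof.
move=> z1; have z0 : 0 < z by exact: lt_le_trans z1.
have tail M : (N <= M)%N ->
    `|series (exp_coeff x) M - \sum_(t < N) x ^+ t / t`!%:R|
      <= expR (z * `|x|) / z ^+ N.
  move=> NM; rewrite /series/= (big_cat_nat _ NM)//= big_mkord addrAC subrr add0r.
  apply: le_trans (ler_norm_sum _ _ _) _.
  rewrite ler_pdivlMr ?exprn_gt0// mulr_suml.
  apply: le_trans (exp_partial_sum_le M _); last by rewrite mulr_ge0// ltW.
  (* the terms below N of the series of exp (z |x|) are dropped *)
  rewrite [leRHS](big_cat_nat _ NM)//=.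
  apply: ler_wpDl.
    by apply: sumr_ge0 => t _; rewrite divr_ge0// exprn_ge0// mulr_ge0// ltW.
  rewrite !big_nat; apply: ler_sum => t /andP[Nt _].
  rewrite normrM normrX normfV normr_nat exprMn mulrAC.
  rewrite ler_wpM2r// mulrC ler_wpM2r ?exprn_ge0//.
  exact: ler_weXn2l.
have cv := is_cvg_series_exp_coeff x.
have near_tail (P : R -> Prop) :
    (forall M, (N <= M)%N -> P (series (exp_coeff x) M)) ->
    (\forall M \near \oo, P (series (exp_coeff x) M))%classic.
  by move=> h; exists N.
rewrite ler_distl; apply/andP; split.
  apply: limr_ge => //; apply: (near_tail (fun y => _ <= y)) => M /tail.
  by rewrite ler_distl => /andP[].
apply: limr_le => //; apply: (near_tail (fun y => y <= _)) => M /tail.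
by rewrite ler_distl => /andP[].
Qed.

Lemma horner_Poly_sum (R : comNzRingType) (s : seq R) (x : R) :
  (Poly s).[x] = \sum_(t < size s) s`_t * x ^+ t.
Proof.
rewrite horner_Poly; elim: s => [|a s IH] /=; first by rewrite big_ord0.
rewrite big_ord_recl /= expr0 mulr1 IH mulr_suml addrC; congr (_ + _).
by apply: eq_bigr => t _; rewrite exprSr mulrA.
Qed.

Lemma taylor_ops (R : realType) (eta Rmax teps : R) :
  let m := Num.truncn (8 * ln teps^-1) in
  ops (taylor eta Rmax teps) = (5 + m + m.+1 ^ 2)%N.
Proof.
move=> m; have -> : (m.+1 ^ 2 = \sum_(t < m.+1) (t + (t + 1)))%N.
  by elim: (m.+1) => [|k IH]; rewrite ?big_ord0// big_ord_recr/= -IH; lia.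
rewrite [LHS]/ops /= -/m; lia.
Qed.

Lemma taylor_result (R : realType) (eta Rmax teps : R) :
  result (taylor eta Rmax teps) =
  mkseq (fun t => (- eta) ^+ t / t`!%:R) (Num.truncn (8 * ln teps^-1)).+1.
Proof. by []. Qed.

(** With L = ln(1/teps), the argument is at most L in absolute value and the
    number of terms is at least 8 L, so the choice z = e in the remainder gives
    exp(e L - 8 L), which is at most teps = exp(- L) because e <= 7.  The
    constant 77 = 8^2 + 8 + 5 absorbs the operation count, quadratic in L. *)
Lemma taylor_exp_approx (R : realType) : exp_approx 77 (@taylor R).
Proof.
move=> eta Rmax teps eta0 Rmax0 teps0 teps_le a.
have L_ge : eta * Rmax <= ln teps^-1.
  by rewrite lnV// lerNr -(expRK (- _)) ler_ln// posrE expR_gt0.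
set L := ln teps^-1 in L_ge *.
have L0 : 0 <= L by apply: le_trans L_ge; rewrite mulr_ge0// ltW.
have /andP[m_le m_gt] :
    (Num.truncn (8 * L))%:R <= 8 * L < (Num.truncn (8 * L)).+1%:R.
  by apply: truncn_itv; lra.
rewrite /a taylor_result -/L size_mkseq -pred_Sn taylor_ops -/L.
move: m_le m_gt; set m := Num.truncn _ => m_le m_gt.
split => [|x xR|].
- by apply: le_trans m_le _; lra.
- rewrite horner_Poly_sum size_mkseq.
  under eq_bigr => t _.
    rewrite nth_mkseq// mulrAC -exprMn mulNr; over.
  have e1 : 1 <= expR 1 :> R by rewrite -[leLHS]expR0 ler_expR.
  apply: le_trans (exp_taylor_remainder _ _ e1) _.
  rewrite -expRM_natl -expRB mulr1.
  have -> : teps = expR (- L) by rewrite /L lnV// opprK lnK.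
  rewrite ler_expR.
  have x_le : `|- (eta * x)| <= L.
    apply: le_trans L_ge; rewrite normrN normrM gtr0_norm//.
    by rewrite ler_wpM2l ?(ltW eta0)// ler_norml.
  (* from 1 - 1/2 <= exp (- 1/2), that is, exp (1/2) <= 2 *)
  have e7 : expR 1 <= 7 :> R.
    have h : expR (- 2^-1) * expR 2^-1 = 1 :> R.
      by rewrite -expRD addNr expR0.
    have -> : 1 = 2^-1 + 2^-1 :> R by lra.
    have := expR_ge1Dx (- 2^-1 : R); have := expR_gt0 (2^-1 : R).
    by rewrite expRD; nra.
  suff : expR 1 * `|- (eta * x)| <= 7 * L by lra.
  by apply: ler_pM => //; exact: expR_ge0.
- apply: (@le_trans _ _ (77 * (1 + L) ^+ 2)).
    rewrite !natrD natrX -natr1; nra.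
  by rewrite ler_wpM2l// ler_weXn2l//; lra.
Qed.

(** * The low-rank factorization of a polynomial of a tensor *)

(** Truncated exponential series multiply like exponentials up to the degree of
    truncation: this is exp(x) exp(y) = exp(x + y), read on coefficients. *)
Lemma coef_prod_exp_poly (F : numFieldType) (I : Type) (s : seq I) (x : I -> F)
    (m t : nat) : (t <= m)%N ->
  (\prod_(i <- s) \poly_(e < m.+1) (x i ^+ e / e`!%:R))`_t
    = (\sum_(i <- s) x i) ^+ t / t`!%:R.
Proof.
have factU e : e`!%:R != 0 :> F by rewrite pnatr_eq0 -lt0n fact_gt0.
elim: s t => [|i s IH] t tm.
  by rewrite !big_nil coef1 expr0n; case: t tm => [|t] _; rewrite ?divr1 ?mul0r.
rewrite !big_cons coefM addrC exprDn mulr_suml; apply: eq_bigr => e _.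
have et : (e <= t)%N by rewrite -ltnS.
rewrite coef_poly ltnS (leq_trans et tm) IH ?(leq_trans (leq_subr _ _) tm)//.
rewrite -(bin_fact et) !natrM -mulr_natr.
have := factU e; have := factU (t - e)%N.
have := bin_gt0 t e; rewrite et -(ltr0n F) => /lt0r_neq0.
set b := 'C(t, e)%:R; set p := _`!%:R; set q := _`!%:R => b0 p0 q0.
field; by rewrite b0 p0 q0.
Qed.

(** Both sides are the coefficient of degree t in a product of truncated
    exponential series; distributing that product over the sums enumerates the
    exponents. *)
Lemma multinomial_theorem (F : numFieldType) (r m t : nat) (x : 'I_r -> F) :
  (t <= m)%N ->
  \sum_(al : {ffun 'I_r -> 'I_m.+1} | (\sum_(l < r) al l == t)%N)
     \prod_(l < r) (x l ^+ al l / (al l)`!%:R)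
  = (\sum_(l < r) x l) ^+ t / t`!%:R.
Proof.
move=> tm; rewrite -(coef_prod_exp_poly _ _ tm).
under [in RHS]eq_bigr => l _ do rewrite poly_def.
rewrite bigA_distr_bigA/= coef_sum big_mkcond/=; apply: eq_bigr => al _.
under [in RHS]eq_bigr => l _ do rewrite -mul_polyC.
rewrite [in RHS]big_split/= prodrXr -rmorph_prod coefCM coefXn eq_sym.
by case: eqP; rewrite ?mulr1 ?mulr0.
Qed.

(** The form of the multinomial theorem that the vectors $v_{i,\alpha}$ encode:
    multi-indices are grouped by weight, and each weight t contributes one
    power of the sum. *)
Lemma sum_multi_index (F : numFieldType) (r m : nat) (c : nat -> F)
    (x : 'I_r -> F) :
  \sum_(al : multi_index r m)
     (weight al)`!%:R / \prod_(l < r) (val al l)`!%:R * c (weight al)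
     * \prod_(l < r) x l ^+ val al l
  = \sum_(t < m.+1) c t * (\sum_(l < r) x l) ^+ t.
Proof.
pose w (al : {ffun 'I_r -> 'I_m.+1}) := (\sum_(l < r) al l)%N.
pose f al := (w al)`!%:R / \prod_(l < r) (al l)`!%:R * c (w al)
     * \prod_(l < r) x l ^+ al l.
transitivity (\sum_(al | (w al <= m)%N) f al).
  by rewrite [RHS](big_sub [pred al | (w al <= m)%N]).
rewrite (partition_big (fun al => inord (w al) : 'I_m.+1) xpredT)//=.
apply: eq_bigr => t _; have tm : (t <= m)%N by rewrite -ltnS.
(* the normalization by 1/t! under which the multinomial theorem is stated *)
rewrite -[_ ^+ t](mulfVK (_ : t`!%:R != 0)) ?pnatr_eq0 -?lt0n ?fact_gt0//.
rewrite -(multinomial_theorem _ tm) mulr_suml mulr_sumr.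
apply: eq_big => [al|al /andP[wm /eqP <-]].
  apply/andP/eqP => [[wm /eqP <-]|wt]; rewrite -/(w al).
    by rewrite inordK.
  rewrite -/(w al) in wt; rewrite wt tm; split => //.
  by apply/eqP/val_inj; rewrite /= inordK.
rewrite /f inordK// big_split/= prodfV; ring.
Qed.

(** * The value computed by the algorithm *)

Lemma maxnorm_ge (R : realType) n k (A : tensor R n k) j : `|A j| <= maxnorm A.
Proof. exact: (le_bigmax _ (fun j => `|A j|)). Qed.

Lemma maxnorm_ge0 (R : realType) n k (A : tensor R n k) : 0 <= maxnorm A.
Proof. exact: bigmax_ge_id. Qed.

(** Enumerating the non-zero entries computes a sum over all positions as soon
    as the zero entries contribute nothing. *)
Lemma sum_nonzero_entries (R : realType) n k (A : tensor R n k)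
    (S : seq (idx n k * R)) (F : idx n k -> R -> R) :
  nonzero_entries A S -> (forall j, F j 0 = 0) ->
  \sum_(e <- S) F e.1 e.2 = \sum_j F j (A j).
Proof.
move=> [uS memS] F0.
rewrite (eq_big_seq (fun e => F e.1 (A e.1))) => [|[j x] /memS [<-]//].
rewrite -(big_map fst xpredT (fun j => F j (A j))) big_uniq//= big_mkcond/=.
apply: eq_bigr => j _; case: ifPn => // jS.
case: (eqVneq (A j) 0) => [->|Aj]; first by rewrite F0.
case/negP: jS; apply/mapP; exists (j, A j) => //; exact/memS.
Qed.

Lemma size_nonzero_entries (R : realType) n k (A : tensor R n k)
    (S : seq (idx n k * R)) (s : nat) :
  nonzero_entries A S -> sparse A s -> (size S <= s)%N.
Proof.
move=> [uS memS]; apply: leq_trans.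
rewrite -(size_map fst) -(card_uniqP uS); apply: subset_leq_card.
apply/fintype.subsetP => _ /mapP [[j x] /memS [<- xN0] ->].
by rewrite inE.
Qed.

Lemma factor_entry_result (R : realType) n k r (u : factors R n k r) (a : seq R)
    m (i : 'I_k) (al : multi_index r m) (j : 'I_n) :
  result (factor_entryT u a i al j) =
  (if val i == 0%N then
     (weight al)`!%:R / \prod_(l < r) (val al l)`!%:R * a`_(weight al)
   else 1) * \prod_(l < r) u i l j ^+ val al l.
Proof.
by rewrite /factor_entryT /result/=; case: ifP => _;
  rewrite /result/= ?mul1r !big_enum.
Qed.

(** The entry of a product of powers is the product of the entries, so that
    exchanging the products over i and l turns the sum over multi-indices into
    the expansion of the powers of an entry of the tensor.  When k = 0 there is
    no first vector to carry the scalar coefficients. *)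
Lemma low_rank_entry (R : realType) n k r (u : factors R n k r) (a : seq R)
    (j : idx n k) : (1 <= k)%N ->
  \sum_(al : multi_index r (size a).-1)
     \prod_(i < k) result (factor_entryT u a i al (j i))
  = (Poly a).[cp_tensor u j].
Proof.
move=> k1; pose x l := \prod_(i < k) u i l (j i).
transitivity (\sum_(t < (size a).-1.+1) a`_t * (\sum_(l < r) x l) ^+ t).
  rewrite -(sum_multi_index _ (fun t => a`_t)); apply: eq_bigr => al _.
  under eq_bigr => i _ do rewrite factor_entry_result.
  rewrite big_split/=; congr (_ * _).
    by case: k k1 u j x => // k _ *; rewrite [LHS]big_ord_recl/=
      [X in _ * X]big1// mulr1.
  by rewrite exchange_big/=; apply: eq_bigr => l _; rewrite prodrXl.
have -> : cp_tensor u j = \sum_(l < r) x l by rewrite ffunE.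
(* an empty list of coefficients yields degree 0 and the coefficient 0 *)
rewrite horner_Poly_sum; case: a => [|a0 a]//=.
by rewrite big_ord0 big1// => t _; rewrite nth_nil mul0r.
Qed.

(** The summands of b are factored, so the product of sums over the vectors
    distributes into a sum over positions; each summand of a has the factor
    exp(- eta x) - 1, which vanishes at x = 0. *)
Lemma algA_result (R : realType) n k r (G : subroutine R) (u : factors R n k r)
    (St : tensor R n k) (S : seq (idx n k * R)) (p : 'I_k -> 'I_n -> \bar R)
    (Rmax eps : R) :
  (1 <= k)%N -> nonzero_entries St S ->
  let eta := 2 * k%:R * ln n%:R / eps in
  let q := Poly (result (G eta Rmax (eps / 3 * expR (- (eta * Rmax))))) in
  result (algA G u Rmax S p eps) =
  ((- eta^-1)%:E * lne (\sum_(j : idx n k)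
     (\prod_(i < k) fine (expeR (eta%:E * p i (j i))))
     * q.[cp_tensor u j] * expR (- eta * St j))%:E)%E.
Proof.
move=> k1 nzS eta; set a := result _ => q.
pose d i j := fine (expeR (eta%:E * p i j)).
pose v i (al : multi_index r (size a).-1) j := result (factor_entryT u a i al j).
(* the value of the program with its bookkeeping of operations erased *)
have -> : result (algA G u Rmax S p eps) =
  ((- eta^-1)%:E * lne (
     \sum_(e <- S) \prod_(i <- enum 'I_k) d i (e.1 i)
       * (\sum_(al <- enum {: multi_index r (size a).-1})
            \prod_(i <- enum 'I_k) v i al (e.1 i))
       * (expR (- eta * e.2) - 1)
   + \sum_(al <- enum {: multi_index r (size a).-1}) \prod_(i <- enum 'I_k)
       \sum_(j <- enum 'I_n) d i j * v i al j)%:E)%E by [].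
congr (_ * lne _%:E)%E.
pose L (j : idx n k) := \sum_al \prod_(i < k) v i al (j i).
pose P (j : idx n k) := \prod_(i < k) d i (j i).
have LE j : L j = q.[cp_tensor u j] by exact: low_rank_entry.
transitivity (\sum_j P j * L j * (expR (- eta * St j) - 1) + \sum_j P j * L j).
  congr (_ + _).
    rewrite -(sum_nonzero_entries
      (F := fun j x => P j * L j * (expR (- eta * x) - 1)) nzS).
      apply: eq_bigr => e _; rewrite !big_enum/=; congr (_ * _ * _).
      by apply: eq_bigr => al _; rewrite big_enum.
    by move=> j; rewrite mulr0 expR0 subrr mulr0.
  rewrite big_enum/=; under eq_bigr => al _.
    rewrite big_enum/=; under eq_bigr => i _ do rewrite big_enum/=.
    rewrite bigA_distr_bigA/=; over.
  rewrite exchange_big/=; apply: eq_bigr => j _.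
  by rewrite /L mulr_sumr; apply: eq_bigr => al _; rewrite big_split.
by rewrite -big_split/=; apply: eq_bigr => j _; rewrite LE /P mulrBr mulr1 subrK.
Qed.

(** * Soft minima and minima *)

(** The law exp(a + b) = exp(a) exp(b) extends to -oo with exp(-oo) = 0.
    Excluding +oo is part of the induction: it keeps the sums defined. *)
Lemma expeR_scaled_sum (R : realType) (eta : R) (k : nat) (x : 'I_k -> \bar R) :
  0 < eta -> (forall i, x i != +oo%E) ->
  \sum_(i < k) x i != +oo%E /\
  expeR (eta%:E * \sum_(i < k) x i)%E
    = (\prod_(i < k) fine (expeR (eta%:E * x i)%E))%:E.
Proof.
move=> eta0 xNy.
have etaNy (y : \bar R) : y != +oo%E -> (eta%:E * y)%E != +oo%E.
  by case: y => [y| |]//= _; rewrite gt0_muleNy ?lte_fin.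
apply: (big_ind2 (fun y z => y != +oo%E /\ expeR (eta%:E * y)%E = z%:E)).
- by rewrite mule0 expeR0.
- move=> y1 z1 y2 z2 [y1Ny E1] [y2Ny E2].
  have y12 : (y1 +? y2)%E by case: y1 y2 y1Ny y2Ny {E1 E2} => [?| |] [?| |].
  split; first by case: y1 y2 y1Ny y2Ny {E1 E2 y12} => [?| |] [?| |].
  by rewrite muleDr// expeRD E1 E2.
- move=> i _; split => //; rewrite fineK//.
  rewrite fin_numE expeR_eqy etaNy// andbT gt_eqF//.
  by rewrite (lt_le_trans _ (expeR_ge0 _))// ltNy0.
Qed.

Lemma SMIN_eq (R : realType) n k (C : tensor R n k) (p : 'I_k -> 'I_n -> \bar R)
    (eta : R) : 0 < eta -> (forall i j, p i j != +oo%E) ->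
  SMIN C p eta = ((- eta^-1)%:E * lne (\sum_(j : idx n k)
     (\prod_(i < k) fine (expeR (eta%:E * p i (j i)))) * expR (- eta * C j))%:E)%E.
Proof.
move=> eta0 pNy; rewrite /SMIN -sumEFin; congr (_ * lne _)%E.
apply: eq_bigr => j _.
have [sNy sE] := expeR_scaled_sum eta0 (fun i => pNy i (j i)).
move: sNy sE; set q := (\sum_(i < k) p i (j i))%E => qNy qE.
have Cq : ((C j)%:E +? - q)%E by case: q qNy {qE}.
have qN : ((- eta)%:E * - q = eta%:E * q)%E by rewrite EFinN muleNN.
by rewrite muleDr// qN expeRD qE [RHS]EFinM muleC.
Qed.

Lemma SMIN_real (R : realType) n k (C : tensor R n k) (p : 'I_k -> 'I_n -> R)
    (eta : R) : (0 < n)%N ->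
  SMIN C (fun i j => (p i j)%:E) eta =
  (- eta^-1 * ln (\sum_(j : idx n k) expR (- eta * (C j - \sum_(i < k) p i (j i)))))%:E.
Proof.
move=> n0; rewrite /SMIN EFinM; congr (_ * _)%E.
under eq_bigr => j _ do rewrite sumEFin -EFinB -EFinM /=.
rewrite sumEFin lne_EFin// (bigD1 [ffun => Ordinal n0])//=.
rewrite ltr_pwDl ?expR_gt0// sumr_ge0// => j _; exact: expR_ge0.
Qed.

(** The sum of exponentials lies between its term at a minimizer of the cost C
    and n^k times a bound on each term; in both estimates the cost is moved by
    at most delta. *)
Lemma SMIN_approximates_AMIN (R : realType) n k (C Ct : tensor R n k)
    (p : 'I_k -> 'I_n -> R) (eta delta : R) :
  (0 < n)%N -> 0 < eta -> maxnorm (C - Ct) <= delta ->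
  (`|SMIN Ct (fun i j => (p i j)%:E) eta - AMIN C p|
     <= (delta + k%:R * ln n%:R / eta)%:E)%E.
Proof.
move=> n0 eta0 CCt.
pose f (A : tensor R n k) j := A j - \sum_(i < k) p i (j i).
have f_close j : `|f C j - f Ct j| <= delta.
  have := maxnorm_ge (C - Ct) j; rewrite !ffunE/= => h.
  by rewrite opprB addrA subrK (le_trans h).
have [j0 _ minE] : {j0 | j0 \in xpredT & AMIN C p = (f C j0)%:E}.
  by apply: (@eq_bigmin _ _ _ _ [ffun => Ordinal n0]) => // j _; rewrite leey.
have min_le j : f C j0 <= f C j by rewrite -lee_fin -minE; exact: bigmin_le.
rewrite SMIN_real// minE -EFinB abse_EFin lee_fin.
pose Z := \sum_(j : idx n k) expR (- eta * f Ct j); rewrite -/Z.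
have nk0 : 0 < n%:R ^+ k :> R by rewrite exprn_gt0 ?ltr0n.
have Z_lb : expR (- eta * (f C j0 + delta)) <= Z.
  rewrite /Z (bigD1 j0)//= ler_wpDr ?sumr_ge0//.
  rewrite ler_expR !mulNr lerN2 ler_wpM2l ?(ltW eta0)//.
  by move: (f_close j0); rewrite ler_distl => /andP[]; lra.
have Z0 : 0 < Z by apply: lt_le_trans Z_lb; exact: expR_gt0.
have Z_ub : Z <= n%:R ^+ k * expR (- eta * (f C j0 - delta)).
  have -> : n%:R ^+ k = #|idx n k|%:R :> R.
    by rewrite card_ffun !card_ord natrX.
  rewrite mulr_natl -sumr_const; apply: ler_sum => j _.
  rewrite ler_expR !mulNr lerN2 ler_wpM2l ?(ltW eta0)//.
  by move: (f_close j) (min_le j); rewrite ler_distl => /andP[]; lra.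
have lb : - eta * (f C j0 + delta) <= ln Z.
  by rewrite -[leLHS]expRK ler_ln ?posrE ?expR_gt0.
have ub : ln Z <= k%:R * ln n%:R - eta * (f C j0 - delta).
  rewrite -mulNr -[X in _ + X]expRK mulr_natl -lnXn ?ltr0n// -lnM ?posrE ?expR_gt0//.
  by rewrite ler_ln ?posrE// mulr_gt0// expR_gt0.
have kln : 0 <= k%:R * ln n%:R / eta.
  by rewrite divr_ge0 ?(ltW eta0)// mulr_ge0// ln_ge0// ler1n.
have lb' : - (f C j0 + delta) <= ln Z / eta.
  by rewrite ler_pdivlMr//; apply: le_trans lb; rewrite mulNr mulrC mulNr.
have ub' : ln Z / eta <= k%:R * ln n%:R / eta - (f C j0 - delta).
  rewrite ler_pdivrMr//; apply: (le_trans ub).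
  by rewrite mulrBl divfK ?gt_eqF// (mulrC eta).
rewrite mulNr (mulrC _^-1) ler_distl; lra.
Qed.

(** A relative error of delta on the exponential is an absolute error on the
    logarithm.  The lower side ln(1 - delta) dominates the upper side because
    (1 + delta)(1 - delta) <= 1. *)
Lemma log_perturbation (R : realType) (eta x y delta : R) :
  0 < eta -> delta < 1 ->
  `|expR (- (eta * x)) - y| <= delta * expR (- (eta * x)) ->
  0 < y /\ `|x - - eta^-1 * ln y| <= - ln (1 - delta) / eta.
Proof.
move=> eta0 d1; set e := expR _ => h.
have e0 : 0 < e by exact: expR_gt0.
have d0 : 0 <= delta by rewrite -(pmulr_lge0 _ e0) (le_trans _ h).
move: h; rewrite ler_distlC => /andP[lo hi].
have lo' : (1 - delta) * e <= y by lra.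
have hi' : y <= (1 + delta) * e by lra.
have y0 : 0 < y by apply: lt_le_trans lo'; rewrite mulr_gt0// subr_gt0.
split=> //.
have lne : ln e = - (eta * x) by rewrite /e expRK.
have l1 : ln (1 - delta) - eta * x <= ln y.
  by rewrite -lne -lnM ?posrE ?subr_gt0// ler_ln ?posrE// mulr_gt0// subr_gt0.
have l2 : ln y <= - ln (1 - delta) - eta * x.
  have d2 : 0 < 1 + delta by lra.
  rewrite -lne -lnV ?posrE ?subr_gt0// -lnM ?posrE ?invr_gt0 ?subr_gt0//.
  rewrite ler_ln ?posrE// ?mulr_gt0 ?invr_gt0 ?subr_gt0//.
  apply: le_trans hi' _; rewrite ler_wpM2r ?(ltW e0)//.
  rewrite -[leRHS]mul1r ler_pdivlMr ?subr_gt0//; nra.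
rewrite ler_pdivlMr// -{2}(gtr0_norm eta0) -normrM mulNr opprK mulrDl.
rewrite mulrAC mulVf ?gt_eqF// mul1r ler_norml; lra.
Qed.

(** * Counting operations *)

Lemma card_multi_index r m : (#|{: multi_index r m}| <= m.+1 ^ r)%N.
Proof.
rewrite card_sig; apply: leq_trans (max_card _) _.
by rewrite card_ffun !card_ord.
Qed.

Lemma factor_entry_ops (R : realType) n k r (u : factors R n k r) (a : seq R) m
    (i : 'I_k) (al : multi_index r m) (j : 'I_n) :
  (ops (factor_entryT u a i al j) <= 3 * m + 2 * r + 3)%N.
Proof.
have w_le : (weight al <= m)%N by exact: (valP al).
have sumS : (\sum_(l <- enum 'I_r) (val al l).+1 = weight al + r)%N.
  rewrite big_enum/=; under eq_bigr => l _ do rewrite -[(val al l).+1]addn1.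
  by rewrite big_split/= sum1_card card_ord.
rewrite /factor_entryT /multinomialT /ops/= sumS.
by case: (val i == 0%N); rewrite /ops/= ?sumS; lia.
Qed.

(** An upper bound for the number of operations, polynomial in the operations g
    of the subroutine, the degree m, n, k and s.  It is defined over any ring so
    that it can be evaluated at polynomials in one size parameter as well as at
    numbers. *)
Section Cost.
Variable (A : comNzRingType) (r : nat).

Definition cost (g m n k s : A) : A :=
  let M := (m + 1) ^+ r in
  15 + g + k * M * n * (3 * m + 2 * r%:R + 3) + k * n * 2
  + s * (k + M * (k + 1) + 6) + M * (1 + k * (1 + n * 2)).

End Cost.

Lemma sum_seq_const (I : Type) (s : seq I) (b : nat) :
  (\sum_(i <- s) b = size s * b)%N.
Proof. by rewrite big_const_seq count_predT iter_addn_0 mulnC. Qed.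

(** The summands of [cost] are, in order: the operations on scalars, the
    subroutine, the table of the vectors $v_{i,\alpha}$, the table of the vectors
    $d_i$, the sum over the sparse entries, and the sum over multi-indices. *)
Lemma algA_ops (R : realType) n k r (G : subroutine R) (u : factors R n k r)
    (S : seq (idx n k * R)) (s : nat) (p : 'I_k -> 'I_n -> \bar R)
    (Rmax eps : R) (eta := 2 * k%:R * ln n%:R / eps)
    (x := G eta Rmax (eps / 3 * expR (- (eta * Rmax)))) :
  (size S <= s)%N ->
  (ops (algA G u Rmax S p eps))%:R <=
  cost r (ops x)%:R ((size (result x)).-1)%:R n%:R k%:R s%:R :> R.
Proof.
move=> Ss; set a := result x; set m := (size a).-1.
pose V := (\sum_(y : 'I_k * multi_index r m * 'I_n)
             ops (factor_entryT u a y.1.1 y.1.2 y.2))%N.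
have -> : ops (algA G u Rmax S p eps) =
  (9 + (ops x + (V + (\sum_(y : 'I_k * 'I_n) 2
   + (1 + (\sum_(e <- S) (\sum_(i <- enum 'I_k) 1
        + (\sum_(al <- enum {: multi_index r m}) (\sum_(i <- enum 'I_k) 1).+1
        + 5)).+1
   + (\sum_(al <- enum {: multi_index r m})
         (\sum_(i <- enum 'I_k) (\sum_(j <- enum 'I_n) 2).+1).+1
   + 5)))))))%N by [].
rewrite sum_nat_const !sum_seq_const -!cardE !card_prod !card_ord.
have M_le := card_multi_index r m; set M := #|_| in M_le *.
have V_le : (V <= k * M * n * (3 * m + 2 * r + 3))%N.
  apply: (@leq_trans
    (\sum_(y : 'I_k * multi_index r m * 'I_n) (3 * m + 2 * r + 3))%N).
    by rewrite /V; apply: leq_sum => y _; exact: factor_entry_ops.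
  by rewrite sum_nat_const !card_prod !card_ord.
apply: (@le_trans _ _ (15 + ops x + k * m.+1 ^ r * n * (3 * m + 2 * r + 3)
  + k * n * 2 + s * (k + m.+1 ^ r * (k + 1) + 6)
  + m.+1 ^ r * (1 + k * (1 + n * 2)))%N%:R); last first.
  by rewrite /cost -[m.+1]addn1 !(natrD, natrM, natrX).
rewrite ler_nat.
have V_le' : (V <= k * m.+1 ^ r * n * (3 * m + 2 * r + 3))%N.
  by apply: leq_trans V_le _; rewrite !leq_mul.
have SA_le : (size S * (k * 1 + (M * (k * 1).+1 + 5)).+1
    <= s * (k + m.+1 ^ r * (k + 1) + 6))%N.
  apply: leq_mul => //; rewrite muln1 -[k.+1]addn1.
  by have := leq_mul M_le (leqnn (k + 1)); lia.
have SB_le : (M * (k * (n * 2).+1).+1 <= m.+1 ^ r * (1 + k * (1 + n * 2)))%N.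
  exact: leq_mul.
lia.
Qed.

(** The single constant K serves both as a factor and as an exponent: it exceeds
    the degree and the sum of the absolute values of the coefficients. *)
Lemma poly_growth (R : archiRealFieldType) (p : {poly R}) :
  exists K : nat, forall x : R, 1 <= x -> p.[x] <= K%:R * x ^+ K.
Proof.
pose b := \sum_(i < size p) `|p`_i|.
have b0 : 0 <= b by apply: sumr_ge0 => i _; exact: normr_ge0.
exists (maxn (Num.truncn b).+1 (size p)) => x x1.
have x0 : 0 <= x by exact: le_trans x1.
apply: (@le_trans _ _ (b * x ^+ size p)).
  rewrite horner_coef mulr_suml; apply: ler_sum => i _.
  rewrite (le_trans (ler_norm _))// normrM normrX (ger0_norm x0).
  by rewrite ler_wpM2l// ler_weXn2l// ltnW.
apply: ler_pM => //; rewrite ?exprn_ge0//; last by rewrite ler_weXn2l// leq_maxr.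
by rewrite (le_trans (ltW (truncnS_gt b)))// ler_nat leq_maxl.
Qed.

Lemma horner_cost (A : comNzRingType) (r : nat) (g m n k s : {poly A}) (x : A) :
  (cost r g m n k s).[x] = cost r g.[x] m.[x] n.[x] k.[x] s.[x].
Proof.
rewrite -!horner_evalE /cost.
by rewrite !(rmorphD, rmorphM, rmorphXn, rmorph1, rmorph_nat).
Qed.

Lemma le_cost (R : numDomainType) (r : nat) (g m n k s g' m' n' k' s' : R) :
  0 <= m -> 0 <= n -> 0 <= k -> 0 <= s ->
  g <= g' -> m <= m' -> n <= n' -> k <= k' -> s <= s' ->
  cost r g m n k s <= cost r g' m' n' k' s'.
Proof.
move=> m0 n0 k0 s0 gg mm nn kk ss; rewrite /cost.
have M0 : 0 <= (m + 1) ^+ r by rewrite exprn_ge0// addr_ge0.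
have MM : (m + 1) ^+ r <= (m' + 1) ^+ r.
  by rewrite lerXn2r ?nnegrE ?lerD2r// addr_ge0// (le_trans m0).
by repeat first [exact: lexx | exact: ler0n | exact: ler01 | assumption
  | apply: lerD | apply: ler_pM | apply: addr_ge0 | apply: mulr_ge0].
Qed.

(** A positive fraction is at least the inverse of its denominator. *)
Lemma ln_inv_dyadic (R : realType) (x : R) (b : nat) :
  0 < x -> bit_complexity_le x b -> ln x^-1 <= b%:R.
Proof.
move=> x0 [num [den [den0 xE _ den_lt]]].
have den0' : 0 < den%:R :> R by rewrite ltr0n.
have num1 : (1 <= num)%R.
  by move: x0; rewrite xE pmulr_lgt0 ?invr_gt0// ltr0z.
have x_inv : x^-1 <= 2 ^+ b.
  rewrite xE invf_div (@le_trans _ _ den%:R)//.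
    by rewrite ler_pdivrMr ?ltr0z// ler_peMr ?(ltW den0')// ler1z.
  by rewrite -natrX ler_nat ltnW.
rewrite (@le_trans _ _ (ln (2 ^+ b)))//.
  by rewrite ler_ln ?posrE ?invr_gt0// exprn_gt0.
rewrite lnXn// -(mulr_natl (ln 2)) ler_piMr//.
have -> : 2 = 1 + 1 :> R by [].
by apply: le_ln1Dx; lra.
Qed.

(** * The guarantees of the algorithm *)

Lemma temperature_gt0 (R : realType) (n k : nat) (eps : R) :
  (2 <= n)%N -> (1 <= k)%N -> 0 < eps -> 0 < 2 * k%:R * ln n%:R / eps.
Proof.
by move=> n2 k1 e0; rewrite divr_gt0// !mulr_gt0 ?ltr0n// ln_gt0// ltr1n.
Qed.

Lemma tolerance_bounds (R : realType) (eps y : R) : 0 < eps -> eps <= 3 ->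
  0 < eps / 3 * expR y <= expR y.
Proof.
move=> e0 e3; rewrite mulr_gt0 ?expR_gt0 ?divr_gt0//= ler_piMl ?expR_ge0//.
lra.
Qed.
(** The nearby cost is - ln(q(R_j)) / eta + S_j, which makes the summands of the
    soft minimum literally those of the algorithm.  The assumption on eps says
    that - ln(1 - eps/3) is at most k ln n = eta eps/2. *)
Lemma algA_result_SMIN (R : realType) n k r (G : subroutine R) c
    (C Rt St : tensor R n k) (u : factors R n k r) (S : seq (idx n k * R))
    (eps : R) (eta := 2 * k%:R * ln n%:R / eps) :
  exp_approx c G -> (2 <= n)%N -> (1 <= k)%N -> C = Rt + St ->
  Rt = cp_tensor u -> nonzero_entries St S ->
  0 < eps -> eps / 3 <= 1 - (n%:R ^+ k)^-1 ->
  exists Ct : tensor R n k, maxnorm (C - Ct) <= eps / 2 /\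
    forall p : 'I_k -> 'I_n -> \bar R, (forall i j, p i j != +oo%E) ->
      result (algA G u (maxnorm Rt) S p eps) = SMIN Ct p eta.
Proof.
move=> GP n2 k1 CE RtE nzS eps0 eps_le.
have nk0 : 0 < n%:R ^+ k :> R by rewrite exprn_gt0// ltr0n ltnW.
have d1 : eps / 3 < 1.
  have : 0 < (n%:R ^+ k)^-1 :> R by rewrite invr_gt0.
  lra.
have eta0 : 0 < eta by exact: temperature_gt0.
set Rmax := maxnorm Rt; have Rmax0 : 0 <= Rmax by exact: maxnorm_ge0.
pose teps := eps / 3 * expR (- (eta * Rmax)).
have /andP[teps0 teps_le] : 0 < teps <= expR (- (eta * Rmax)).
  by apply: tolerance_bounds => //; lra.
pose q := Poly (result (G eta Rmax teps)).
have approx j : 0 < q.[Rt j] /\ `|Rt j - - eta^-1 * ln q.[Rt j]| <= eps / 2.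
  have [_ /(_ (Rt j)) qP _] := GP _ _ _ eta0 Rmax0 teps0 teps_le.
  have Rj : - Rmax <= Rt j <= Rmax by rewrite -ler_norml maxnorm_ge.
  have h : `|expR (- (eta * Rt j)) - q.[Rt j]| <= eps / 3 * expR (- (eta * Rt j)).
    apply: le_trans (qP Rj) _; rewrite /teps ler_wpM2l ?divr_ge0 ?(ltW eps0)//.
    by rewrite ler_expR lerN2 ler_wpM2l ?(ltW eta0)//; case/andP: Rj.
  have [q0 /le_trans ->//] := log_perturbation eta0 d1 h.
  rewrite ler_pdivrMr// /eta.
  have -> : eps / 2 * (2 * k%:R * ln n%:R / eps) = - ln (n%:R ^+ k)^-1.
    rewrite lnV ?posrE// opprK lnXn ?ltr0n ?(ltnW n2)// -mulr_natl.
    by field; rewrite gt_eqF.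
  rewrite lerN2 ler_ln ?posrE ?invr_gt0 ?subr_gt0//; lra.
exists [ffun j => - eta^-1 * ln q.[Rt j] + St j]; split.
  apply: bigmax_le => [|j _]; first by rewrite divr_ge0// ltW.
  rewrite CE !ffunE/= opprD addrACA subrr addr0.
  by case: (approx j).
move=> p pNy; rewrite (algA_result _ _ _ _ _ k1 nzS) SMIN_eq// -/eta -/teps -/q -RtE.
congr (_ * lne _%:E)%E; apply: eq_bigr => j _; rewrite ffunE -mulrA; congr (_ * _).
rewrite mulrDr expRD mulrA mulrNN mulfV ?gt_eqF// mul1r lnK//.
by case: (approx j).
Qed.

(** Every size is at most x = n + k + s + Cmax/eps, and ln(1/teps) is at most the
    polynomial lam below evaluated at x.  Substituting these bounds in [cost],
    which is monotone, leaves a polynomial in x alone, and x >= 1. *)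
Lemma algA_polynomial_time (R : realType) (r c c0 cb : nat) :
  exists K : nat, forall (G : subroutine R) n k s (u : factors R n k r)
      (S : seq (idx n k * R)) (Rmax Cmax eps : R)
      (p : 'I_k -> 'I_n -> \bar R),
    exp_approx c G -> (2 <= n)%N -> (1 <= k)%N -> (size S <= s)%N ->
    0 <= Cmax -> 0 <= Rmax -> Rmax <= c0%:R * Cmax -> 0 < eps -> eps <= 3 ->
    bit_complexity_le eps (cb * (n + k) ^ cb)%N ->
    (ops (algA G u Rmax S p eps))%:R <=
      K%:R * (n%:R + k%:R + s%:R + Cmax / eps) ^+ K.
Proof.
have [lam lamE] : exists lam : {poly R}, forall x,
    lam.[x] = 2 + cb%:R * x ^+ cb + 2 * c0%:R * x ^+ 3.
  exists (2%:P + cb%:R%:P * 'X^cb + (2 * c0%:R)%:P * 'X^3) => x.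
  by rewrite !(hornerXn, hornerD, hornerM, hornerC).
have [K KP] := poly_growth
  (cost r (c%:R%:P * (1%:P + lam) ^+ c) (c%:R%:P * lam) 'X 'X 'X).
exists K => G n k s u S Rmax Cmax eps p GP n2 k1 Ss Cmax0 Rmax0 Rmax_le
  eps0 eps3 eps_bits.
set y := Cmax / eps; have y0 : 0 <= y by rewrite divr_ge0 ?(ltW eps0).
have n2R : 2 <= n%:R :> R by rewrite ler_nat.
have k1R : 1 <= k%:R :> R by rewrite ler1n.
have s0R : 0 <= s%:R :> R by [].
set x := _ + y.
have [nx kx sx yx x1] : [/\ n%:R <= x, k%:R <= x, s%:R <= x, y <= x & 1 <= x].
  by rewrite /x; split; lra.
have x0 : 0 <= x by exact: le_trans x1.
have lnn : 0 < ln n%:R :> R by rewrite ln_gt0// ltr1n.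
pose eta := 2 * k%:R * ln n%:R / eps.
have eta0 : 0 < eta by exact: temperature_gt0.
pose teps := eps / 3 * expR (- (eta * Rmax)).
have /andP[teps0 teps_le] : 0 < teps <= expR (- (eta * Rmax)).
  exact: tolerance_bounds.
have L0 : 0 <= ln teps^-1.
  rewrite ln_ge0// invf_ge1// (le_trans teps_le)// expR_le1 oppr_le0.
  by rewrite mulr_ge0// ltW.
(* ln n <= n and Rmax <= c0 Cmax, so eta Rmax is cubic in x *)
have etaR_le : eta * Rmax <= 2 * c0%:R * x ^+ 3.
  have -> : eta * Rmax = 2 * (k%:R * (ln n%:R * (Rmax / eps))).
    by rewrite /eta; field; rewrite gt_eqF.
  have -> : 2 * c0%:R * x ^+ 3 = 2 * (x * (x * (c0%:R * x))) by ring.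
  have Re : Rmax / eps <= c0%:R * x.
    rewrite (@le_trans _ _ (c0%:R * y))//; last by rewrite ler_wpM2l.
    by rewrite /y mulrA ler_wpM2r// invr_ge0 ltW.
  have Re0 : 0 <= Rmax / eps by rewrite divr_ge0 ?(ltW eps0).
  rewrite ler_wpM2l// ler_pM//; first by rewrite mulr_ge0// ltW.
  rewrite ler_pM// ?(ltW lnn)//; apply: le_trans nx; apply/ltW/ln_sublinear.
  lra.
have bits_le : ln eps^-1 <= cb%:R * x ^+ cb.
  apply: le_trans (ln_inv_dyadic eps0 eps_bits) _.
  rewrite natrM natrX ler_wpM2l// lerXn2r ?nnegrE// natrD /x; lra.
have ln3 : ln 3 <= 2 :> R.
  have -> : 3 = 1 + 2 :> R by ring.
  by apply: le_ln1Dx; lra.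
have L_le : ln teps^-1 <= lam.[x].
  have -> : ln teps^-1 = ln 3 + ln eps^-1 + eta * Rmax.
    rewrite /teps lnV ?posrE// lnM ?posrE ?divr_gt0 ?expR_gt0// expRK.
    rewrite ln_div ?posrE// lnV ?posrE//; ring.
  by rewrite lamE; lra.
have [m_le _ g_le] := GP _ _ _ eta0 Rmax0 teps0 teps_le.
apply: le_trans (algA_ops _ _ _ _ _ Ss) _; rewrite -/eta -/teps.
apply: le_trans (KP x x1).
rewrite horner_cost !(hornerX, hornerM, horner_exp, hornerD, hornerC).
apply: le_cost => //; last first.
  by rewrite (le_trans m_le)// ler_wpM2l.
by rewrite (le_trans g_le)// ler_wpM2l// lerXn2r ?nnegrE//; lra.
Qed.

Theorem theorem7p4 (R : realType) :
  (* the polynomial required by step (2) exists and can be computed *)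
  (exists c : nat, exp_approx c (@taylor R)) /\
  (* c, c0, cb: constants of the degree bound, of the bounds
     ||Rt||, ||St|| = O(||C||), and of the bit complexity poly(n, k) *)
  forall r c c0 cb : nat,
  exists K : nat,
  forall (G : subroutine R), exp_approx c G ->
  forall (n k s : nat) (C Rt St : tensor R n k)
         (u : factors R n k r) (S : seq (idx n k * R)) (eps : R),
    (2 <= n)%N -> (1 <= k)%N ->
    C = Rt + St -> tensor_rank Rt r -> sparse St s ->
    Rt = cp_tensor u -> nonzero_entries St S ->
    maxnorm Rt <= c0%:R * maxnorm C -> maxnorm St <= c0%:R * maxnorm C ->
    0 < eps ->
    (* implied by eps <= 3/2; it makes log(1 / (1 - eps/3)) / eta <= eps/2 *)
    eps / 3 <= 1 - (n%:R ^+ k)^-1 ->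
    let algo := fun p => algA G u (maxnorm Rt) S p eps in
    let eta := 2 * k%:R * ln n%:R / eps in
    [/\ (* running time *)
        bit_complexity_le eps (cb * (n + k) ^ cb)%N ->
        forall p : 'I_k -> 'I_n -> \bar R,
          (forall i j, p i j != +oo%E) ->
          (ops (algo p))%:R <=
            K%:R * (n%:R + k%:R + s%:R + maxnorm C / eps) ^+ K,
        (* approximate AMIN oracle *)
        forall p : 'I_k -> 'I_n -> R,
          (`|result (algo (fun i j => (p i j)%:E)) - AMIN C p| <= eps%:E)%E
      & (* exact SMIN oracle of a nearby tensor *)
        exists Ct : tensor R n k,
          maxnorm (C - Ct) <= eps / 2 /\
          forall p : 'I_k -> 'I_n -> \bar R,
            (forall i j, p i j != +oo%E) ->
            result (algo p) = SMIN Ct p eta].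
Proof.
split; first by exists 77%N; exact: taylor_exp_approx.
move=> r c c0 cb; have [K timeP] := algA_polynomial_time R r c c0 cb.
exists K => G GP n k s C Rt St u S eps n2 k1 CE _ sparseS RtE nzS Rt_le _ eps0
  eps_le algo eta.
have nk1 : 1 <= n%:R ^+ k :> R by rewrite exprn_ege1// ler1n ltnW.
have [Ct [CCt resE]] := algA_result_SMIN GP n2 k1 CE RtE nzS eps0 eps_le.
have lnn : 0 < ln n%:R :> R by rewrite ln_gt0// ltr1n.
have eta0 : 0 < eta by exact: temperature_gt0.
split.
- move=> epsb p _; apply: timeP => //.
  + exact: size_nonzero_entries sparseS.
  + exact: maxnorm_ge0.
  + exact: maxnorm_ge0.
  + have : 0 < (n%:R ^+ k)^-1 :> R by rewrite invr_gt0 (lt_le_trans _ nk1).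
    lra.
- move=> p; rewrite /algo resE//.
  have kln : k%:R * ln n%:R / eta = eps / 2.
    by rewrite /eta; field; rewrite !gt_eqF// ltr0n.
  have := SMIN_approximates_AMIN p (ltnW n2) eta0 CCt.
  by rewrite kln -splitr.
- by exists Ct.
Qed.
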